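(* Let $\mathfrak{C}$ be an $A$-coring such that there exists $g\in\mathbf{Gal}(\mathfrak{C})$ and the action of $U(A)$ on $\mathbf{Gal}(\mathfrak{C})$ by $(\alpha,h)\mapsto\alpha h\alpha^{-1}$ is transitive (for example, this holds when $U(A)$ acts transitively by conjugation on the set of all grouplike elements, i.e. $\mathscr{D}^1(\mathfrak{C},g)=\{1\}$). The following statements are equivalent: (i) $U(A)_g=U(A)$ (i.e., $\alpha A^g=A^g\alpha$ for every $\alpha\in U(A)$); (ii) $U(A)_h=U(A)$ for every $h\in\mathbf{Gal}(\mathfrak{C})$; (iii) the action of $\mathbf{Aut}(\mathfrak{C})$ on $\mathbf{Gal}(\mathfrak{C})$, $(\varphi,h)\mapsto\varphi(h)$, is transitive. Furthermore, if one of these equivalent conditions is satisfied, then $A^h=A^g$ for every $h\in\mathbf{Gal}(\mathfrak{C})$, and the map $\xi_g:\mathbf{Aut}(\mathfrak{C})\to\mathbf{Gal}(\mathfrak{C})$ defined by $\xi_g(\varphi)=\varphi(g)$ is bijective; thus $\mathbf{Gal}(\mathfrak{C})$ can be endowed with the structure of a group (transported from $\mathbf{Aut}(\mathfrak{C})$ along $\xi_g$). Moreover, for this group structure there exists a short exact sequence of groups $$\{1\}\to U(A^g)\to U(A)\to\mathbf{Gal}(\mathfrak{C})\to\{1\},$$ where $U(A^g)\to U(A)$ is the inclusion.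
   Context: $K$ is a commutative ring and $A$ an (associative unital) $K$-algebra; $U(-)$ denotes the group of units of a ring. An $A$-coring is an $A$-bimodule $\mathfrak{C}$ with $A$-bimodule maps $\Delta:\mathfrak{C}\to\mathfrak{C}\otimes_A\mathfrak{C}$ and $\varepsilon:\mathfrak{C}\to A$ satisfying the coassociativity and counit axioms. A homomorphism of $A$-corings is an $A$-bimodule map compatible with comultiplications and counits; $\mathbf{Aut}(\mathfrak{C})$ is the group of $A$-coring automorphisms of $\mathfrak{C}$. A grouplike element is $g\in\mathfrak{C}$ with $\Delta(g)=g\otimes_A g$ and $\varepsilon(g)=1$; $\mathbf{Gr}(\mathfrak{C})$ is the set of these. For $g\in\mathbf{Gr}(\mathfrak{C})$, $A^g=\{a\in A: ag=ga\}$, a subring of $A$. A grouplike $g$ is Galois if the canonical map $\mathsf{can}_g:A\otimes_{A^g}A\to\mathfrak{C}$, $a\otimes a'\mapsto aga'$, is bijective; $\mathbf{Gal}(\mathfrak{C})$ is the set of Galois grouplike elements. It is stable under the conjugation action $(\alpha,g)\mapsto\alpha g\alpha^{-1}$ of $U(A)$ and under the action $(\varphi,g)\mapsto\varphi(g)$ of $\mathbf{Aut}(\mathfrak{C})$. $\mathscr{D}^1(\mathfrak{C},g)$ is the set of orbits of the conjugation action of $U(A)$ on $\mathbf{Gr}(\mathfrak{C})$, pointed by the orbit of $g$. For $g\in\mathbf{Gr}(\mathfrak{C})$, $U(A)_g=\{\alpha\in U(A):\alpha A^g=A^g\alpha\}$. *)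

(* Defs.v *)
From HB Require Import structures.
From mathcomp Require Import all_boot all_algebra.
From mathcomp Require Import freeg.
From mathcomp Require Import boolp classical_sets.

Set Implicit Arguments.
Unset Strict Implicit.
Unset Printing Implicit Defensive.

Import GRing.Theory.
Local Open Scope ring_scope.
Local Open Scope quotient_scope.
Local Open Scope classical_set_scope.

(* Balanced tensor products.  For a ring S, a right S-module M and a left      *)
(* S-module N, [tensor ra la] is M (x)_S N, i.e. the free abelian group on     *)
(* M * N modulo the subgroup generated by the usual relations.  Only the two   *)
(* actions [ra : M -> S -> M] and [la : S -> N -> N] enter the construction.   *)
Section Tensor.
Variables (S : Type) (M N : zmodType) (ra : M -> S -> M) (la : S -> N -> N).

Local Notation F := {freeg (M * N)%type / int}.

Inductive tensor_relation : F -> Prop :=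
| TensorDl m m' n : tensor_relation (<<(m + m', n)>> - <<(m, n)>> - <<(m', n)>>)
| TensorDr m n n' : tensor_relation (<<(m, n + n')>> - <<(m, n)>> - <<(m, n')>>)
| TensorA m s n : tensor_relation (<<(ra m s, n)>> - <<(m, la s n)>>).

Definition tensor_relations : {pred F} := fun x =>
  `[< forall I : {pred F}, zmod_closed I ->
        (forall y, tensor_relation y -> y \in I) -> x \in I >].

Fact tensor_relations_closed : zmod_closed tensor_relations.
Proof.
split.
  by apply/asboolP => I [I0 _] _.
move=> x y /asboolP xI /asboolP yI; apply/asboolP => I Icl Irel.
by case: (Icl) => _; apply; [exact: xI|exact: yI].
Qed.

HB.instance Definition _ :=
  GRing.isZmodClosed.Build F tensor_relations tensor_relations_closed.

Definition tensor := Quotient.quot tensor_relations.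
HB.instance Definition _ := GRing.Zmodule.on tensor.

Definition pure (m : M) (n : N) : tensor := \pi_tensor (<<(m, n)>> : F).

Definition balanced (V : zmodType) (f : M -> N -> V) :=
  [/\ forall n, {morph f^~ n : m m' / m + m'},
      forall m, {morph f m : n n' / n + n'}
    & forall m s n, f (ra m s) n = f m (la s n)].

(* When f is balanced, this is the additive map sending m (x) n to f m n       *)
(* (see tensor_liftE and tensor_liftD).                                        *)
Definition tensor_lift (V : zmodType) (f : M -> N -> V) (t : tensor) : V :=
  fglift (fun p => f p.1 p.2 : zmodule V) (repr t).
End Tensor.

Arguments pure {S M N ra la}.
Arguments tensor_lift {S M N ra la V}.

Section TensorTheory.
Variables (S : Type) (M N : zmodType) (ra : M -> S -> M) (la : S -> N -> N).

Local Notation F := {freeg (M * N)%type / int}.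
Local Notation T := (tensor ra la).

Lemma pi_tensorD : {morph \pi_T : x y / x + y}.
Proof. by move=> x y; rewrite [LHS]Quotient.pi_add. Qed.

Lemma pi_tensorN : {morph \pi_T : x / - x}.
Proof. by move=> x; rewrite [LHS]Quotient.pi_opp. Qed.

Lemma pi_tensor0 : \pi_T 0 = 0.
Proof. by apply: (addrI (\pi_T 0)); rewrite -pi_tensorD !addr0. Qed.

Lemma pi_tensorP (x y : F) :
  reflect (\pi_T x = \pi_T y) (x - y \in tensor_relations ra la).
Proof. by rewrite Quotient.idealrBE; exact: eqP. Qed.

Lemma pi_tensor_relation (x : F) : tensor_relation ra la x -> \pi_T x = 0.
Proof.
move=> xR; rewrite -pi_tensor0; apply/pi_tensorP; rewrite subr0.
by apply/asboolP => I _; exact.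
Qed.

Lemma tensorDl m m' n : pure (m + m') n = pure m n + pure m' n :> T.
Proof.
apply/eqP; rewrite -subr_eq0 opprD addrA -!pi_tensorN -!pi_tensorD.
by apply/eqP/pi_tensor_relation; exact: TensorDl.
Qed.

Lemma tensorDr m n n' : pure m (n + n') = pure m n + pure m n' :> T.
Proof.
apply/eqP; rewrite -subr_eq0 opprD addrA -!pi_tensorN -!pi_tensorD.
by apply/eqP/pi_tensor_relation; exact: TensorDr.
Qed.

Lemma tensorA m s n : pure (ra m s) n = pure m (la s n) :> T.
Proof.
apply/eqP; rewrite -subr_eq0 -!pi_tensorN -!pi_tensorD.
by apply/eqP/pi_tensor_relation; exact: TensorA.
Qed.

Lemma pure_balanced : balanced ra la (pure : M -> N -> T).
Proof. split=> [n m m'|m n n'|m s n] /=.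
- exact: tensorDl.
- exact: tensorDr.
- exact: tensorA. Qed.

Lemma tensor0l n : pure 0 n = 0 :> T.
Proof. by apply: (addrI (pure 0 n)); rewrite -tensorDl !addr0. Qed.

Lemma tensor0r m : pure m 0 = 0 :> T.
Proof. by apply: (addrI (pure m 0)); rewrite -tensorDr !addr0. Qed.

Lemma tensorNl m n : pure (- m) n = - pure m n :> T.
Proof. by apply: (addrI (pure m n)); rewrite -tensorDl !subrr tensor0l. Qed.

Lemma tensor_ind (P : T -> Prop) : (forall m n, P (pure m n)) ->
  (forall x y, P x -> P y -> P (x + y)) -> forall t, P t.
Proof.
move=> Pp PD t; have PN k m n : P (pure m n *+ k).
  elim: k => [|k IH]; first by rewrite mulr0n -(tensor0l n).
  by rewrite mulrS; apply: PD.
have PU (k : int) m n : P (\pi_T <<k *g (m, n)>>).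
  have piMn (j : nat) : \pi_T (<<(m, n)>> *+ j : F) = pure m n *+ j.
    elim: j => [|j IH]; first by rewrite !mulr0n pi_tensor0.
    by rewrite !mulrS pi_tensorD IH.
  have -> : <<k *g (m, n)>> = (<<(m, n)>> : F) *~ k.
    by rewrite freeg_mulz; congr (<<_ *g _>>); rewrite intz.
  case: k => j; first by rewrite -pmulrn piMn.
  rewrite NegzE mulrNz pi_tensorN -pmulrn piMn -mulNrn -tensorNl.
  exact: PN.
rewrite -[t]reprK -[repr t]freeg_sumE.
elim/big_ind: _ => [|x y|[m n] _].
- by rewrite pi_tensor0 -(tensor0l 0).
- by rewrite pi_tensorD; exact: PD.
- exact: PU.
Qed.

Section Lift.
Variables (V : zmodType) (f : M -> N -> V).
Hypothesis fB : balanced ra la f.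

Local Notation L := (fglift (fun p : M * N => f p.1 p.2 : zmodule V)).

Let LB (x y : F) : L (x - y) = L x - L y.
Proof. exact: lift_is_additive. Qed.

Let L0 : L 0 = 0.
Proof. by rewrite -(subrr 0) LB subrr. Qed.

Let LD (x y : F) : L (x + y) = L x + L y.
Proof. by rewrite -{1}[y]opprK LB -[- y]sub0r LB L0 sub0r opprK. Qed.

Let LU m n : L <<(m, n)>> = f m n.
Proof. by rewrite liftU scale1r. Qed.

Let L_relations (x : F) : x \in tensor_relations ra la -> L x = 0.
Proof.
move=> /asboolP /(_ [pred y | L y == 0]) xI; apply/eqP; apply: xI.
  split; first by rewrite inE L0.
  by move=> u v; rewrite !inE LB => /eqP -> /eqP ->; rewrite subr0.
case: fB => fDl fDr fA y yR; rewrite inE; apply/eqP.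
have e (a b : V) : a + b - a - b = 0 by rewrite -addrA -opprD subrr.
case: yR => [m m' n|m n n'|m s n]; rewrite !LB !LU ?fDl ?fDr ?fA ?subrr //;
  exact: e.
Qed.

Lemma tensor_lift_pi (x : F) : tensor_lift f (\pi_T x) = L x.
Proof.
apply/eqP; rewrite -subr_eq0 -LB; apply/eqP/L_relations/pi_tensorP.
by rewrite reprK.
Qed.

Lemma tensor_liftE m n : tensor_lift f (pure m n : T) = f m n.
Proof. by rewrite tensor_lift_pi LU. Qed.

Lemma tensor_liftD : {morph tensor_lift f : t u / t + u : T >-> t + u}.
Proof.
by move=> t u; rewrite -[t]reprK -[u]reprK -pi_tensorD !tensor_lift_pi LD.
Qed.
End Lift.

Lemma tensor_ext (V : zmodType) (f h : T -> V) :
    {morph f : t u / t + u} -> {morph h : t u / t + u} ->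
  (forall m n, f (pure m n) = h (pure m n)) -> f =1 h.
Proof. by move=> fD hD fh; elim/tensor_ind => // x y ex ey; rewrite fD hD ex ey. Qed.
End TensorTheory.

HB.mixin Record Lmodule_isBimodule (A : pzRingType) M of GRing.Lmodule A M := {
  rscale : M -> A -> M;
  rscaleA : forall m a b, rscale m (a * b) = rscale (rscale m a) b;
  rscale1 : forall m, rscale m 1 = m;
  rscaleDl : forall m n a, rscale (m + n) a = rscale m a + rscale n a;
  rscaleDr : forall m a b, rscale m (a + b) = rscale m a + rscale m b;
  scale_rscale : forall a m b, a *: rscale m b = rscale (a *: m) b
}.

#[short(type="bimodType")]
HB.structure Definition Bimodule (A : pzRingType) :=
  {M of GRing.Lmodule A M & Lmodule_isBimodule A M}.

Notation "m *:r a" := (rscale m a) (at level 40, left associativity) : ring_scope.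

Definition bimod_hom (A : pzRingType) (M N : bimodType A) (f : M -> N) :=
  linear f /\ forall m a, f (m *:r a) = f m *:r a.

Section BimodHom.
Variables (A : pzRingType) (M N : bimodType A) (f : M -> N).
Hypothesis fH : bimod_hom f.

Lemma bimod_homD : {morph f : m n / m + n}.
Proof. by case: fH => fl _ m n; have := fl 1 m n; rewrite !scale1r. Qed.

Lemma bimod_hom0 : f 0 = 0.
Proof. by apply: (addrI (f 0)); rewrite -bimod_homD !addr0. Qed.

Lemma bimod_homZ a m : f (a *: m) = a *: f m.
Proof. by case: fH => fl _; have := fl a m 0; rewrite bimod_hom0 !addr0. Qed.

Lemma bimod_homZr m a : f (m *:r a) = f m *:r a.
Proof. by case: fH. Qed.
End BimodHom.

Section Bitensor.
Variable A : pzRingType.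

Definition bitensor (M N : bimodType A) :=
  tensor (@rscale A M) ( *:%R : A -> N -> N).

HB.instance Definition _ (M N : bimodType A) := GRing.Zmodule.on (bitensor M N).

Definition tens (M N : bimodType A) (m : M) (n : N) : bitensor M N := pure m n.
Local Notation "m *t n" := (tens m n) (at level 40, left associativity).

Definition bilift (M N : bimodType A) (V : zmodType) (f : M -> N -> V)
    (t : bitensor M N) : V := tensor_lift f t.

Definition bibalanced (M N : bimodType A) (V : zmodType) (f : M -> N -> V) :=
  balanced (@rscale A M) ( *:%R : A -> N -> N) f.

Definition tensor_map (M N M' N' : bimodType A) (f : M -> M') (h : N -> N') :
    bitensor M N -> bitensor M' N' :=
  bilift (fun m n => f m *t h n).

Section Theory.
Variables M N : bimodType A.
Local Notation T := (bitensor M N).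

Lemma tensDl (m m' : M) (n : N) : (m + m') *t n = m *t n + m' *t n.
Proof. exact: tensorDl. Qed.

Lemma tensDr (m : M) (n n' : N) : m *t (n + n') = m *t n + m *t n'.
Proof. exact: tensorDr. Qed.

Lemma tensA (m : M) a (n : N) : (m *:r a) *t n = m *t (a *: n).
Proof. exact: tensorA. Qed.

Lemma bitensor_ind (P : T -> Prop) : (forall m n, P (m *t n)) ->
  (forall t u, P t -> P u -> P (t + u)) -> forall t, P t.
Proof. exact: tensor_ind. Qed.

Lemma biliftE (V : zmodType) (f : M -> N -> V) m n :
  bibalanced f -> bilift f (m *t n) = f m n.
Proof. by move=> fB; exact: tensor_liftE. Qed.

Lemma biliftD (V : zmodType) (f : M -> N -> V) :
  bibalanced f -> {morph bilift f : t u / t + u}.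
Proof. by move=> fB; exact: tensor_liftD. Qed.

Lemma bitensor_ext (V : zmodType) (f h : T -> V) :
    {morph f : t u / t + u} -> {morph h : t u / t + u} ->
  (forall m n, f (m *t n) = h (m *t n)) -> f =1 h.
Proof. exact: tensor_ext. Qed.

End Theory.

Section Map.
Variables (M N M' N' : bimodType A) (f : M -> M') (h : N -> N').
Hypotheses (fD : {morph f : m n / m + n}).
Hypotheses (fr : forall m a, f (m *:r a) = f m *:r a).
Hypotheses (hD : {morph h : m n / m + n}).
Hypotheses (hl : forall a n, h (a *: n) = a *: h n).

Lemma tensor_map_balanced : bibalanced (fun m n => f m *t h n).
Proof.
split=> [n m m'|m n n'|m a n] /=.
- by rewrite fD tensDl.
- by rewrite hD tensDr.
- by rewrite fr hl tensA.
Qed.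

Lemma tensor_mapE m n : tensor_map f h (m *t n) = f m *t h n.
Proof. exact: biliftE tensor_map_balanced. Qed.

Lemma tensor_mapD : {morph tensor_map f h : t u / t + u}.
Proof. exact: (biliftD tensor_map_balanced). Qed.
End Map.

Section Actions.
Variables M N : bimodType A.
Local Notation T := (bitensor M N).

Definition bitensor_scale (a : A) : T -> T := tensor_map (fun m => a *: m) idfun.

Definition bitensor_rscale (t : T) (a : A) : T :=
  tensor_map idfun (fun n => n *:r a) t.

Lemma bitensor_scaleE a m n : bitensor_scale a (m *t n) = (a *: m) *t n.
Proof.
by apply: tensor_mapE => // [x y|x b] /=; rewrite ?scalerDr ?scale_rscale.
Qed.

Lemma bitensor_scaleD a : {morph bitensor_scale a : t u / t + u}.
Proof.
by apply: tensor_mapD => // [x y|x b] /=; rewrite ?scalerDr ?scale_rscale.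
Qed.

Lemma bitensor_rscaleE m n a : bitensor_rscale (m *t n) a = m *t (n *:r a).
Proof.
by apply: tensor_mapE => // [x y|b x] /=; rewrite ?rscaleDl ?scale_rscale.
Qed.

Lemma bitensor_rscaleD a : {morph bitensor_rscale^~ a : t u / t + u}.
Proof.
by apply: tensor_mapD => // [x y|b x] /=; rewrite ?rscaleDl ?scale_rscale.
Qed.

Fact bitensor_scaleA a b t :
  bitensor_scale a (bitensor_scale b t) = bitensor_scale (a * b) t.
Proof.
elim/bitensor_ind: t => [m n|t u IHt IHu]; first by rewrite !bitensor_scaleE scalerA.
by rewrite !bitensor_scaleD IHt IHu.
Qed.

Fact bitensor_scale1 : left_id 1 bitensor_scale.
Proof.
elim/bitensor_ind => [m n|t u IHt IHu]; first by rewrite bitensor_scaleE scale1r.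
by rewrite bitensor_scaleD IHt IHu.
Qed.

Fact bitensor_scaleDr : right_distributive bitensor_scale +%R.
Proof. by move=> a t u; rewrite bitensor_scaleD. Qed.

Fact bitensor_scaleDl t : {morph bitensor_scale^~ t : a b / a + b}.
Proof.
move=> a b; elim/bitensor_ind: t => [m n|t u IHt IHu].
  by rewrite !bitensor_scaleE scalerDl tensDl.
by rewrite !bitensor_scaleD IHt IHu addrACA.
Qed.

HB.instance Definition _ := GRing.Zmodule_isLmodule.Build A T
  bitensor_scaleA bitensor_scale1 bitensor_scaleDr bitensor_scaleDl.

Lemma scale_tens a m n : a *: (m *t n : T) = (a *: m) *t n.
Proof. exact: bitensor_scaleE. Qed.

Fact bitensor_rscaleA t a b :
  bitensor_rscale t (a * b) = bitensor_rscale (bitensor_rscale t a) b.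
Proof.
elim/bitensor_ind: t => [m n|t u IHt IHu]; first by rewrite !bitensor_rscaleE rscaleA.
by rewrite !bitensor_rscaleD IHt IHu.
Qed.

Fact bitensor_rscale1 t : bitensor_rscale t 1 = t.
Proof.
elim/bitensor_ind: t => [m n|t u IHt IHu]; first by rewrite bitensor_rscaleE rscale1.
by rewrite bitensor_rscaleD IHt IHu.
Qed.

Fact bitensor_rscaleDr t a b :
  bitensor_rscale t (a + b) = bitensor_rscale t a + bitensor_rscale t b.
Proof.
elim/bitensor_ind: t => [m n|t u IHt IHu].
  by rewrite !bitensor_rscaleE rscaleDr tensDr.
by rewrite !bitensor_rscaleD IHt IHu addrACA.
Qed.

Fact bitensor_rscaleDl t u a :
  bitensor_rscale (t + u) a = bitensor_rscale t a + bitensor_rscale u a.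
Proof. exact: bitensor_rscaleD. Qed.

Fact bitensor_scale_rscale a t b :
  a *: bitensor_rscale t b = bitensor_rscale (a *: t) b.
Proof.
elim/bitensor_ind: t => [m n|t u IHt IHu].
  by rewrite bitensor_rscaleE !scale_tens bitensor_rscaleE.
by rewrite !(bitensor_rscaleD, scalerDr) IHt IHu.
Qed.

HB.instance Definition _ := Lmodule_isBimodule.Build A T
  bitensor_rscaleA bitensor_rscale1 bitensor_rscaleDl bitensor_rscaleDr
  bitensor_scale_rscale.

Lemma rscale_tens a m n : (m *t n : T) *:r a = m *t (n *:r a).
Proof. exact: bitensor_rscaleE. Qed.
End Actions.

Section Associator.
Variables M N P : bimodType A.

Definition tensor_append (p : P) : bitensor M N -> bitensor M (bitensor N P) :=
  bilift (fun m n => m *t (n *t p)).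

(* (m (x) n) (x) p |-> m (x) (n (x) p) *)
Definition tensor_assoc : bitensor (bitensor M N) P -> bitensor M (bitensor N P) :=
  bilift (fun t p => tensor_append p t).

Lemma tensor_append_balanced p : bibalanced
  (fun m n => m *t (n *t p) : bitensor M (bitensor N P)).
Proof.
split=> [n m m'|m n n'|m a n] /=; first exact: tensDl.
  by rewrite -tensDr -tensDl.
by rewrite tensA scale_tens.
Qed.

Lemma tensor_appendE p m n : tensor_append p (m *t n) = m *t (n *t p).
Proof. exact: biliftE (tensor_append_balanced p). Qed.

Lemma tensor_appendD p : {morph tensor_append p : t u / t + u}.
Proof. exact: (biliftD (tensor_append_balanced p)). Qed.

Lemma tensor_assoc_balanced :
  bibalanced
  (fun t p => tensor_append p t).
Proof.
split=> [p t u|t p q|t a p].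
- exact: tensor_appendD.
- elim/bitensor_ind: t => [m n|t u IHt IHu].
    by rewrite !tensor_appendE !tensDr.
  by rewrite !tensor_appendD IHt IHu addrACA.
- elim/bitensor_ind: t => [m n|t u IHt IHu].
    by rewrite rscale_tens !tensor_appendE tensA.
  by rewrite rscaleDl !tensor_appendD IHt IHu.
Qed.

Lemma tensor_assocE m n p :
  tensor_assoc ((m *t n) *t p) = m *t (n *t p).
Proof. by rewrite [LHS]biliftE ?tensor_appendE //; exact: tensor_assoc_balanced. Qed.

Lemma tensor_assocD : {morph tensor_assoc : t u / t + u}.
Proof. exact: (biliftD tensor_assoc_balanced). Qed.
End Associator.
End Bitensor.

Notation "m *t n" := (tens m n) (at level 40, left associativity) : ring_scope.

HB.mixin Record Bimodule_isCoring (A : pzRingType) C of Bimodule A C := {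
  comul : C -> bitensor C C;
  counit : C -> A;
  comul_hom : bimod_hom comul;
  counit_scalar : scalar counit;
  counit_rscale : forall (c : C) a, counit (c *:r a) = counit c * a;
  comulA : forall c, tensor_assoc (tensor_map comul idfun (comul c))
                     = tensor_map idfun comul (comul c);
  counitl : forall c, bilift (fun c1 c2 => counit c1 *: c2) (comul c) = c;
  counitr : forall c, bilift (fun c1 c2 => c1 *:r counit c2) (comul c) = c
}.

#[short(type="coringType")]
HB.structure Definition Coring (A : pzRingType) :=
  {C of Bimodule A C & Bimodule_isCoring A C}.

Arguments comul {A} {_}.
Arguments counit {A} {_}.

Definition coring_hom (A : pzRingType) (C D : coringType A) (f : C -> D) :=
  [/\ bimod_hom f,
      forall c, comul (f c) = tensor_map f f (comul c)
    & forall c, counit (f c) = counit c].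

(* The group of units of a ring that need not be a unitRingType; a unit is     *)
(* paired with its inverse.                                                    *)
Section Units.
Variable R : pzRingType.

Definition units := {u : R * R | (u.1 * u.2 == 1) && (u.2 * u.1 == 1)}.
HB.instance Definition _ := SubChoice.on units.

Definition unit_val (u : units) : R := (val u).1.
Definition unit_inv (u : units) : R := (val u).2.

Lemma unit_mulV u : unit_val u * unit_inv u = 1.
Proof. by case/andP: (valP u) => /eqP. Qed.

Lemma unit_mulVl u : unit_inv u * unit_val u = 1.
Proof. by case/andP: (valP u) => _ /eqP. Qed.

Definition mk_unit (a b : R) (ab : a * b = 1) (ba : b * a = 1) : units :=
  exist _ (a, b) (introT andP (conj (introT eqP ab) (introT eqP ba))).

Lemma unit_val_inj : injective unit_val.
Proof.
have inv_uniq (a b c : R) : b * a = 1 -> a * c = 1 -> b = c.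
  by move=> ba ac; rewrite -[b]mulr1 -ac mulrA ba mul1r.
move=> u v uv; apply: val_inj; apply/eqP; rewrite -pair_eqE /=.
apply/andP; split; apply/eqP; first exact: uv.
apply: (inv_uniq (unit_val u)); first exact: unit_mulVl.
by rewrite uv; exact: unit_mulV.
Qed.

Fact units_one_proof : (1 : R) * 1 = 1. Proof. exact: mulr1. Qed.
Definition units_one : units := mk_unit units_one_proof units_one_proof.
Definition units_inv (u : units) : units := mk_unit (unit_mulVl u) (unit_mulV u).
Fact units_mul_proof u v :
  (unit_val u * unit_val v) * (unit_inv v * unit_inv u) = 1.
Proof. by rewrite -mulrA (mulrA (unit_val v)) unit_mulV mul1r unit_mulV. Qed.
Fact units_mulV_proof u v :
  (unit_inv v * unit_inv u) * (unit_val u * unit_val v) = 1.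
Proof. by rewrite -mulrA (mulrA (unit_inv u)) unit_mulVl mul1r unit_mulVl. Qed.
Definition units_mul (u v : units) : units :=
  mk_unit (units_mul_proof u v) (units_mulV_proof u v).

Fact units_mulA : associative units_mul.
Proof. by move=> u v w; apply: unit_val_inj; exact: mulrA. Qed.
Fact units_mul1 : left_id units_one units_mul.
Proof. by move=> u; apply: unit_val_inj; exact: mul1r. Qed.
Fact units_mulr1 : right_id units_one units_mul.
Proof. by move=> u; apply: unit_val_inj; exact: mulr1. Qed.
Fact units_mulV : left_inverse units_one units_inv units_mul.
Proof. by move=> u; apply: unit_val_inj; exact: unit_mulVl. Qed.
Fact units_mulrV : right_inverse units_one units_inv units_mul.
Proof. by move=> u; apply: unit_val_inj; exact: unit_mulV. Qed.

HB.instance Definition _ := isGroup.Build units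
  units_mulA units_mul1 units_mulr1 units_mulV units_mulrV.
End Units.

(* [coinv g] is A^g as a subset of A, [coinv_ring g] the same as a ring, and   *)
(* [coinv_tensor g] is A (x)_{A^g} A; [norm_units g] below is U(A)_g.          *)
Section Grouplike.
Variables (A : pzRingType) (C : coringType A).
Implicit Types g h : C.

Definition grouplike g := comul g = g *t g /\ counit g = 1.

Definition coinv g : {pred A} := fun a => a *: g == g *:r a.

Fact coinv_subring g : subring_closed (coinv g).
Proof.
split=> [|a b /eqP ag /eqP bg|a b /eqP ag /eqP bg]; apply/eqP.
- by rewrite scale1r rscale1.
- rewrite scalerBl ag bg; apply: (addIr (g *:r b)).
  by rewrite -rscaleDr !subrK.
- by rewrite -scalerA bg scale_rscale ag rscaleA.
Qed.

HB.instance Definition _ g :=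
  GRing.isSubringClosed.Build A (coinv g) (coinv_subring g).

Definition coinv_ring g := {a : A | coinv g a}.
HB.instance Definition _ g := SubChoice.on (coinv_ring g).
HB.instance Definition _ g :=
  GRing.SubChoice_isSubPzRing.Build A (coinv g) (coinv_ring g) (coinv_subring g).

Definition coinv_tensor g :=
  tensor (fun a (b : coinv_ring g) => a * val b)
         (fun (b : coinv_ring g) a => val b * a).
HB.instance Definition _ g := GRing.Zmodule.on (coinv_tensor g).

Definition can_map g : coinv_tensor g -> C :=
  tensor_lift (fun a a' => (a *: g) *:r a').

Arguments can_map : clear implicits.

Definition galois g := grouplike g /\ bijective (can_map g).
End Grouplike.

Arguments can_map {A C} g t.

Section CoinvUnits.
Variables (A : pzRingType) (C : coringType A) (g : C).

Fact coinv_units_proof (u : units (coinv_ring g)) :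
  val (unit_val u) * val (unit_inv u) = 1 :> A.
Proof. by rewrite -rmorphM unit_mulV rmorph1. Qed.

Fact coinv_units_proofV (u : units (coinv_ring g)) :
  val (unit_inv u) * val (unit_val u) = 1 :> A.
Proof. by rewrite -rmorphM unit_mulVl rmorph1. Qed.

Definition coinv_units (u : units (coinv_ring g)) : units A :=
  mk_unit (coinv_units_proof u) (coinv_units_proofV u).

Fact coinv_unitsM : {morph coinv_units : u v / (u * v)%g}.
Proof. by move=> u v; apply: unit_val_inj; exact: (rmorphM val (unit_val u)). Qed.

HB.instance Definition _ := isMultiplicative.Build
  (units (coinv_ring g)) (units A) coinv_units coinv_unitsM.
End CoinvUnits.

(* A^g contains u^-1 A^h u iff the map a (x) a' |-> a u (x) u^-1 a' from       *)
(* A (x)_{A^h} A to A (x)_{A^g} A makes sense.                                 *)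
Section Retensor.
Variables (A : pzRingType) (C : coringType A).

Definition coinv_conj (g h : C) (u : units A) :=
  forall b, coinv h b -> coinv g (unit_inv u * b * unit_val u).

Definition retensor (g h : C) (u : units A) : coinv_tensor h -> coinv_tensor g :=
  tensor_lift (fun a a' => pure (a * unit_val u) (unit_inv u * a')).

Section Theory.
Variables (g h : C) (u : units A).
Hypothesis ghu : coinv_conj g h u.

Lemma retensor_balanced :
  balanced (fun a (b : coinv_ring h) => a * val b)
    (fun (b : coinv_ring h) a => val b * a)
    (fun a a' => pure (a * unit_val u) (unit_inv u * a') : coinv_tensor g).
Proof.
split=> [a' a b|a a' b'|a b a'].
- by rewrite mulrDl tensorDl.
- by rewrite mulrDr tensorDr.
- pose b' : coinv_ring g := 
    exist (fun x => is_true (coinv g x)) _ (ghu (valP b)).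
  have -> : a * val b * unit_val u = a * unit_val u * val b'.
    by rewrite /= -!mulrA (mulrA (unit_val u)) unit_mulV mul1r.
  have -> : unit_inv u * (val b * a') = val b' * (unit_inv u * a').
    by rewrite /= -!mulrA (mulrA (unit_val u)) unit_mulV mul1r.
  exact: (tensorA _ _ (a * unit_val u) b').
Qed.

Lemma retensorE a a' :
  retensor g u (pure a a' : coinv_tensor h) = pure (a * unit_val u) (unit_inv u * a').
Proof. exact: tensor_liftE retensor_balanced _ _. Qed.

Lemma retensorD : {morph @retensor g h u : t v / t + v}.
Proof. exact: tensor_liftD retensor_balanced. Qed.
End Theory.

Lemma retensorK (g h : C) (u : units A) :
  coinv_conj g h u -> coinv_conj h g (u^-1)%g ->
  cancel (@retensor g h u) (@retensor h g (u^-1)%g).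
Proof.
move=> ghu hgu; elim/tensor_ind => [a a'|t v IHt IHv].
  rewrite (retensorE ghu) (retensorE hgu).
  have -> : a * unit_val u * unit_val (u^-1)%g = a.
    by rewrite -mulrA [X in a * X](unit_mulV u) mulr1.
  have -> // : unit_inv (u^-1)%g * (unit_inv u * a') = a'.
  by rewrite mulrA [X in X * a'](unit_mulV u) mul1r.
by rewrite (retensorD ghu) (retensorD hgu) IHt IHv.
Qed.

Lemma can_balanced (g : C) :
  balanced (fun a (b : coinv_ring g) => a * val b)
    (fun (b : coinv_ring g) a => val b * a)
    (fun a a' => (a *: g) *:r a').
Proof.
split=> [a' a b|a a' b'|a b a'].
- by rewrite scalerDl rscaleDl.
- by rewrite rscaleDr.
- by rewrite -scalerA (eqP (valP b)) scale_rscale rscaleA.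
Qed.

Lemma canE (g : C) a a' : can_map g (pure a a') = (a *: g) *:r a'.
Proof. exact: tensor_liftE (can_balanced g) _ _. Qed.

Lemma canD (g : C) : {morph can_map g : t v / t + v}.
Proof. exact: tensor_liftD (can_balanced g). Qed.
End Retensor.

Lemma bijective_retensor (A : pzRingType) (C : coringType A) (g h : C) u :
  coinv_conj g h u -> coinv_conj h g (u^-1)%g -> bijective (@retensor A C g h u).
Proof.
move=> ghu hgu; exists (@retensor A C h g (u^-1)%g); first exact: retensorK.
move=> t; have := @retensorK A C h g (u^-1)%g hgu.
by rewrite invgK; apply.
Qed.

Section GaloisActions.
Variables (A : pzRingType) (C : coringType A).

Definition gconj (u : units A) (g : C) : C := (unit_val u *: g) *:r unit_inv u.

Lemma counitZ a (c : C) : counit (a *: c) = a * counit c.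
Proof.
have c0 : counit (0 : C) = 0.
  by apply: (addrI (counit (0 : C))); have := @counit_scalar _ C 1 0 0;
    rewrite scaler0 mul1r !addr0.
by have := @counit_scalar _ C a c 0; rewrite !addr0 c0 addr0.
Qed.

Lemma grouplike_conj u g : grouplike g -> grouplike (gconj u g).
Proof.
move=> [gg g1]; split.
  rewrite /gconj (bimod_homZr comul_hom) (bimod_homZ comul_hom) gg.
  rewrite scale_tens rscale_tens tensA; congr (_ *t _).
  by rewrite scale_rscale scalerA unit_mulVl scale1r.
by rewrite /gconj counit_rscale counitZ g1 mulr1 unit_mulV.
Qed.

Lemma gconj1 g : gconj 1%g g = g.
Proof. by rewrite /gconj scale1r rscale1. Qed.

Lemma gconjM u v g : gconj (u * v)%g g = gconj u (gconj v g).
Proof. by rewrite /gconj scale_rscale scalerA -rscaleA. Qed.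

Lemma coinv_conjP u g : coinv_conj g (gconj u g) u.
Proof.
move=> b /eqP; rewrite /gconj scale_rscale => e; apply/eqP.
have := congr1 (fun c => (unit_inv u *: c) *:r unit_val u) e.
rewrite !(scale_rscale, scalerA) -!rscaleA unit_mulVl rscale1 scale1r.
by rewrite !mulrA.
Qed.

Lemma coinv_conjPV u g : coinv_conj (gconj u g) g (u^-1)%g.
Proof. by have := @coinv_conjP (u^-1)%g (gconj u g); rewrite -gconjM mulVg gconj1. Qed.

Lemma can_conj u g t : can_map (gconj u g) t = can_map g (retensor g u t).
Proof.
elim/tensor_ind: t => [a a'|t v IHt IHv].
  rewrite (retensorE (@coinv_conjP u g)) !canE /gconj.
  by rewrite scale_rscale scalerA rscaleA.
by rewrite (retensorD (@coinv_conjP u g)) !canD IHt IHv.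
Qed.

Lemma galois_conj u g : galois g -> galois (gconj u g).
Proof.
move=> [gg gb]; split; first exact: grouplike_conj.
have -> : can_map (gconj u g) = can_map g \o retensor g u.
  by apply/funext => t; exact: can_conj.
apply: bij_comp => //; apply: bijective_retensor; first exact: coinv_conjP.
exact: coinv_conjPV.
Qed.
End GaloisActions.

Definition is_automorphism (A : pzRingType) (C : coringType A) (f : C -> C) :=
  coring_hom f /\ bijective f.

Record coring_aut (A : pzRingType) (C : coringType A) :=
  CoringAut { aut_fun :> C -> C; autP : is_automorphism aut_fun }.

HB.instance Definition _ (A : pzRingType) (C : coringType A) :=
  gen_eqMixin (coring_aut C).
HB.instance Definition _ (A : pzRingType) (C : coringType A) :=
  gen_choiceMixin (coring_aut C).

Section AutomorphismGroup.
Variables (A : pzRingType) (C : coringType A).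
Implicit Types (f h : C -> C) (phi psi : coring_aut C).

Lemma tensor_map_homE f h c d : bimod_hom f -> bimod_hom h ->
  tensor_map f h (c *t d) = f c *t h d.
Proof.
move=> fH hH; apply: tensor_mapE; [exact: bimod_homD|exact: bimod_homZr|..].
  exact: bimod_homD.
exact: bimod_homZ.
Qed.

Lemma tensor_map_homD f h : bimod_hom f -> bimod_hom h ->
  {morph tensor_map f h : t u / t + u}.
Proof.
move=> fH hH; apply: tensor_mapD; [exact: bimod_homD|exact: bimod_homZr|..].
  exact: bimod_homD.
exact: bimod_homZ.
Qed.

Lemma bimod_hom_id : bimod_hom (@id C).
Proof. by []. Qed.

Lemma bimod_hom_comp f h : bimod_hom f -> bimod_hom h -> bimod_hom (f \o h).
Proof.
move=> [fl fr] [hl hr]; split=> [a c d|c a] /=; first by rewrite hl fl.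
by rewrite hr fr.
Qed.

Lemma tensor_map_id t : tensor_map (@id C) (@id C) t = t.
Proof.
elim/bitensor_ind: t => [c d|t u IHt IHu].
  by rewrite tensor_map_homE //; exact: bimod_hom_id.
by rewrite tensor_map_homD ?IHt ?IHu //; exact: bimod_hom_id.
Qed.

Lemma tensor_map_comp f h t : bimod_hom f -> bimod_hom h ->
  tensor_map f f (tensor_map h h t) = tensor_map (f \o h) (f \o h) t.
Proof.
move=> fH hH; have fhH := bimod_hom_comp fH hH.
elim/bitensor_ind: t => [c d|t u IHt IHu].
  by rewrite !tensor_map_homE.
by rewrite !tensor_map_homD // IHt IHu.
Qed.

Lemma coring_hom_id : coring_hom (@id C).
Proof.
by split=> // c; rewrite tensor_map_id.
Qed.

Lemma coring_hom_comp f h : coring_hom f -> coring_hom h -> coring_hom (f \o h).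
Proof.
move=> [fH fD fe] [hH hD he]; split=> [|c|c] /=; first exact: bimod_hom_comp.
  by rewrite fD hD tensor_map_comp.
by rewrite fe he.
Qed.

Lemma coring_hom_inv f h : cancel f h -> cancel h f -> coring_hom f -> coring_hom h.
Proof.
move=> fK hK [fH fD fe].
have hH : bimod_hom h.
  split=> [a c d|c a]; apply: (can_inj fK).
    by rewrite hK (bimod_homD fH) (bimod_homZ fH) !hK.
  by rewrite hK (bimod_homZr fH) hK.
split=> // [c|c]; last by rewrite -fe hK.
rewrite -{2}(hK c) fD tensor_map_comp //.
have -> : h \o f = id by apply/funext => x /=; rewrite fK.
by rewrite tensor_map_id.
Qed.

Lemma coring_aut_eqP phi psi : phi =1 psi -> phi = psi.
Proof.
case: phi psi => [f fP] [h hP] /= /funext fh; move: hP; rewrite -fh => hP.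
by congr CoringAut; exact: Prop_irrelevance.
Qed.

Fact aut_inverse phi : {h | cancel phi h /\ cancel h phi}.
Proof. by apply: cid; case: (autP phi) => _ [h]; exists h. Qed.

Fact aut_one_subproof : is_automorphism (@id C).
Proof. by split; [exact: coring_hom_id|exists id]. Qed.

Fact aut_mul_subproof phi psi : is_automorphism (phi \o psi).
Proof.
case: (autP phi) (autP psi) => fH fB [hH hB].
by split; [exact: coring_hom_comp|exact: bij_comp].
Qed.

Fact aut_inv_subproof phi : is_automorphism (sval (aut_inverse phi)).
Proof.
case: (aut_inverse phi) => h [fK hK] /=; case: (autP phi) => fH _.
by split; [exact: coring_hom_inv fH|exists phi].
Qed.

Definition aut_one : coring_aut C := CoringAut aut_one_subproof.
Definition aut_mul phi psi : coring_aut C := CoringAut (aut_mul_subproof phi psi).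
Definition aut_inv phi : coring_aut C := CoringAut (aut_inv_subproof phi).

Fact aut_mulA : associative aut_mul.
Proof. by move=> *; exact: coring_aut_eqP. Qed.
Fact aut_mul1 : left_id aut_one aut_mul.
Proof. by move=> *; exact: coring_aut_eqP. Qed.
Fact aut_mulr1 : right_id aut_one aut_mul.
Proof. by move=> *; exact: coring_aut_eqP. Qed.
Fact aut_mulV : left_inverse aut_one aut_inv aut_mul.
Proof.
move=> phi; apply: coring_aut_eqP => c /=.
by case: (aut_inverse phi) => h [fK _] /=; exact: fK.
Qed.
Fact aut_mulrV : right_inverse aut_one aut_inv aut_mul.
Proof.
move=> phi; apply: coring_aut_eqP => c /=.
by case: (aut_inverse phi) => h [_ hK] /=; exact: hK.
Qed.

HB.instance Definition _ := isGroup.Build (coring_aut C)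
  aut_mulA aut_mul1 aut_mulr1 aut_mulV aut_mulrV.

Lemma galois_aut phi g : galois g -> galois (phi g).
Proof.
case: (autP phi) => -[fH fD fe] fB [[gg g1] gB]; split.
  by split; [rewrite fD gg tensor_map_homE|rewrite fe].
have coinvE a : coinv (phi g) a = coinv g a.
  by rewrite /coinv -(bimod_homZ fH) -(bimod_homZr fH) (bij_eq fB).
have sub1 : coinv_conj g (phi g) 1%g.
  by move=> b; rewrite coinvE /= mul1r mulr1.
have sub2 : coinv_conj (phi g) g (1^-1)%g.
  by move=> b; rewrite invg1 coinvE /= mul1r mulr1.
have -> : can_map (phi g) = phi \o can_map g \o retensor g 1%g.
  apply/funext; elim/tensor_ind => [a a'|t u IHt IHu] /=.
    rewrite (retensorE sub1) !canE (bimod_homZr fH) (bimod_homZ fH).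
    by rewrite [a * _]mulr1 [_ * a']mul1r.
  by rewrite (retensorD sub1) !canD (bimod_homD fH) IHt IHu.
by apply: bij_comp; [exact: bij_comp|exact: bijective_retensor].
Qed.
End AutomorphismGroup.

Record galois_grouplike (A : pzRingType) (C : coringType A) :=
  Galois { gal_val :> C; galP : galois gal_val }.

Section GaloisSet.
Variables (A : pzRingType) (C : coringType A).
Local Notation Gal := (galois_grouplike C).

Definition gal_conj (u : units A) (h : Gal) : Gal := Galois (galois_conj u (galP h)).

Definition gal_aut (phi : coring_aut C) (h : Gal) : Gal :=
  Galois (galois_aut phi (galP h)).

Definition xi (g : Gal) (phi : coring_aut C) : Gal := gal_aut phi g.
End GaloisSet.

Definition transitive_action (G X : Type) (act : G -> X -> X) :=
  forall x y, exists a, act a x = y.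

Section Normalizing.
Variables (A : pzRingType) (C : coringType A).

Definition norm_units (g : C) : set (units A) :=
  [set u | [set unit_val u * a | a in [set` coinv g]]
           = [set a * unit_val u | a in [set` coinv g]]].

Definition conj_orbit (h : C) : set C := [set gconj u h | u in [set: units A]].

(* D^1(C, g) without its base point, which is the orbit of g. *)
Definition descent1 : set (set C) :=
  [set conj_orbit h | h in [set h : C | grouplike h]].
End Normalizing.

Arguments descent1 {A} C.

(* The type X with the group structure transported from G along f.             *)
Section Transport.
Variables (G : groupType) (X : Type) (f : G -> X).

Definition transported (f_bij : bijective f) : Type := X.

Variable f_bij : bijective f.
Local Notation T := (transported f_bij).

Fact transport_inverse : {h : X -> G | cancel f h /\ cancel h f}.
Proof. by apply: cid; case: f_bij => h; exists h. Qed.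

Definition untransport (x : T) : G := sval transport_inverse x.

HB.instance Definition _ := gen_eqMixin T.
HB.instance Definition _ := gen_choiceMixin T.

Definition transport_one : T := f 1%g.
Definition transport_inv (x : T) : T := f (untransport x)^-1%g.
Definition transport_mul (x y : T) : T := f (untransport x * untransport y)%g.

Lemma transportK (a : G) : untransport (f a) = a.
Proof. by rewrite /untransport; case: transport_inverse => h [fK _] /=. Qed.

Lemma untransportK (x : T) : f (untransport x) = x.
Proof. by rewrite /untransport; case: transport_inverse => h [_ hK] /=. Qed.

Fact transport_mulA : associative transport_mul.
Proof. by move=> x y z; rewrite /transport_mul !transportK mulgA. Qed.
Fact transport_mul1 : left_id transport_one transport_mul.
Proof. by move=> x; rewrite /transport_mul transportK mul1g untransportK. Qed.
Fact transport_mulr1 : right_id transport_one transport_mul.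
Proof. by move=> x; rewrite /transport_mul transportK mulg1 untransportK. Qed.
Fact transport_mulV : left_inverse transport_one transport_inv transport_mul.
Proof. by move=> x; rewrite /transport_mul transportK mulVg. Qed.
Fact transport_mulrV : right_inverse transport_one transport_inv transport_mul.
Proof. by move=> x; rewrite /transport_mul transportK mulgV. Qed.

HB.instance Definition _ := isGroup.Build T
  transport_mulA transport_mul1 transport_mulr1 transport_mulV transport_mulrV.

Lemma transportM (a b : G) : (f (a * b) : T) = ((f a : T) * (f b : T))%g.
Proof.
have e : transport_mul (f a) (f b) = f (a * b)%g.
  by rewrite /transport_mul !transportK.
exact: esym e.
Qed.
End Transport.

(* 1 -> G1 -i-> G2 -p-> G3 -> 1 *)
Definition short_exact (G1 G2 G3 : groupType)
    (i : {multiplicative G1 -> G2}) (p : {multiplicative G2 -> G3}) :=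
  [/\ injective i, range i = [set x | p x = 1%g] & range p = [set: G3]].

(* Main.v *)
Require Import Defs.
From HB Require Import structures.
From mathcomp Require Import all_boot all_algebra.
From mathcomp Require Import boolp classical_sets.

(** A Galois grouplike [g] makes [C] a copy of the canonical coring
    A (x)_{A^g} A, so [C] is spanned additively by the elements a g a'.  Hence a
    bimodule map out of [C] is determined by its value at [g], which gives the
    injectivity of [xi g] ([xi_inj]).  Conversely, if another Galois grouplike
    [h] has the same coinvariants, both can maps start from the same tensor
    product and a g a' |-> a h a' is a well defined coring automorphism carrying
    [g] to [h] ([exists_aut]); since an automorphism never changes coinvariants
    ([coinv_aut]), two Galois grouplikes are in the same Aut(C)-orbit exactly
    when they have the same coinvariants.

    On the side of units, A^(u g u^-1) = u A^g u^-1 ([coinv_gconj]), so [u]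
    normalizes A^g exactly when [g] and its conjugate by [u] have the same
    coinvariants ([norm_unitsP]).  When U(A) acts transitively, the three
    conditions therefore all say that the coinvariants are the same for all
    Galois grouplikes, and [xi g] is then bijective.

    For the exact sequence, let phi_u be the automorphism with
    phi_u(g) = u g u^-1.  By A-linearity phi_u(phi_v(g)) = v u g u^-1 v^-1, so
    u |-> u g u^-1 reverses products in the transported group structure, and the
    homomorphism to use is u |-> u^-1 g u.  It is surjective by transitivity, and
    its kernel consists of the units commuting with [g], that is of the units of
    A^g. *)

Set Implicit Arguments.
Unset Strict Implicit.
Unset Printing Implicit Defensive.

Import GRing.Theory.
Local Open Scope ring_scope.
Local Open Scope classical_set_scope.

Section Coinvariants.
Variables (A : pzRingType) (C : coringType A).
Implicit Types (g h : C) (u : units A).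

Lemma gconj_fixE u g : (gconj u g == g) = coinv g (unit_val u).
Proof.
apply/eqP/eqP => [e|e].
  by rewrite -{2}e /gconj -rscaleA unit_mulVl rscale1.
by rewrite /gconj e -rscaleA unit_mulV rscale1.
Qed.

Lemma coinv_gconj u g a :
  coinv (gconj u g) a = coinv g (unit_inv u * a * unit_val u).
Proof.
apply/idP/idP => [|ga]; first exact: coinv_conjP.
have /= := coinv_conjPV u ga.
by rewrite /unit_inv /unit_val /= !mulrA unit_mulV mul1r -mulrA unit_mulV mulr1.
Qed.

(** If u A^g = A^g u, then conjugation by [u] maps A^g onto itself, and it always
    maps A^g onto the coinvariants of the conjugate grouplike. *)
Lemma norm_unitsP u g : norm_units g u <-> coinv (gconj u g) =i coinv g.
Proof.
split=> [nu a|e].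
  rewrite -!topredE /= coinv_gconj; apply/idP/idP => ga.
    have : [set unit_val u * a | a in [set` coinv g]] (a * unit_val u).
      by exists (unit_inv u * a * unit_val u) => //; rewrite !mulrA unit_mulV mul1r.
    rewrite [X in X _]nu => -[b gb eb].
    by rewrite -[a]mulr1 -(unit_mulV u) mulrA -eb -mulrA unit_mulV mulr1.
  have : [set a * unit_val u | a in [set` coinv g]] (a * unit_val u) by exists a.
  rewrite -[X in X _]nu => -[b gb eb].
  by rewrite -mulrA -eb mulrA unit_mulVl mul1r.
have eb a : coinv g (unit_inv u * a * unit_val u) = coinv g a.
  by rewrite -coinv_gconj; exact: e.
apply/seteqP; split=> _ [a ga <-].
  exists (unit_val u * a * unit_inv u); last by rewrite -mulrA unit_mulVl mulr1.
  by rewrite /= -topredE /= -eb !mulrA unit_mulVl mul1r -mulrA unit_mulVl mulr1.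
exists (unit_inv u * a * unit_val u); last by rewrite !mulrA unit_mulV mul1r.
by rewrite /= -topredE /= eb.
Qed.

Lemma eq_norm_units g h : coinv g =i coinv h -> norm_units g = norm_units h.
Proof.
move=> gh; have e : [set` coinv g] = [set` coinv h].
  by apply/seteqP; split=> a /=; rewrite gh.
by rewrite /norm_units e.
Qed.

Lemma coinv_aut (phi : coring_aut C) g : coinv (phi g) =i coinv g.
Proof.
case: (autP phi) => -[fH _ _] fB a.
by rewrite -!topredE /= /coinv -(bimod_homZ fH) -(bimod_homZr fH) (bij_eq fB).
Qed.

Lemma aut_gconj (phi : coring_aut C) u g : phi (gconj u g) = gconj u (phi g).
Proof.
case: (autP phi) => -[fH _ _] _.
by rewrite /gconj (bimod_homZr fH) (bimod_homZ fH).
Qed.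
End Coinvariants.

Section GaloisGrouplikes.
Variables (A : pzRingType) (C : coringType A).
Implicit Types (g h : C) (u : units A).

Lemma gal_val_inj : injective (@gal_val A C).
Proof.
by case=> x xP [y yP] /= xy; subst y; congr Galois; exact: Prop_irrelevance.
Qed.

Lemma galois_span g (P : C -> Prop) : galois g ->
    (forall a a', P ((a *: g) *:r a')) -> (forall c d, P c -> P d -> P (c + d)) ->
  forall c, P c.
Proof.
move=> [_ [k _ kK]] Pg PD c; rewrite -(kK c).
by elim/tensor_ind: (k c) => [a a'|t v Pt Pv]; rewrite ?canE // canD; exact: PD.
Qed.

Lemma eq_bimod_hom g (M : bimodType A) (f f' : C -> M) : galois g ->
  bimod_hom f -> bimod_hom f' -> f g = f' g -> f =1 f'.
Proof.
move=> gG fH fH' e; apply: (galois_span gG) => [a a'|c d ec ed].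
  by rewrite (bimod_homZr fH) (bimod_homZ fH) (bimod_homZr fH') (bimod_homZ fH') e.
by rewrite (bimod_homD fH) (bimod_homD fH') ec ed.
Qed.

Lemma xi_inj (g : galois_grouplike C) : injective (xi g).
Proof.
move=> phi psi /(congr1 (@gal_val A C)) /= e; apply: coring_aut_eqP.
case: (autP phi) (autP psi) => -[fH _ _] _ [[hH _ _] _].
exact: eq_bimod_hom (galP g) fH hH e.
Qed.

(** The inclusion A^g <= A^h provides a surjection
    A (x)_{A^g} A -> A (x)_{A^h} A, through which the map is defined; only the
    can map of [g] has to be inverted. *)
Lemma exists_coring_hom g h : galois g -> grouplike h ->
    (forall a, coinv g a -> coinv h a) ->
  exists f : C -> C, coring_hom f /\ f g = h.
Proof.
move=> gG [hh h1] sub; have [[gg g1] [k kK Kk]] := gG.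
have sub1 : coinv_conj h g 1%g.
  by move=> b gb; rewrite /= mul1r mulr1; exact: sub.
pose f c := can_map h (retensor h 1%g (k c)).
have kD : {morph k : c d / c + d}.
  by move=> c d; apply: (can_inj kK); rewrite canD !Kk.
have fD : {morph f : c d / c + d}.
  by move=> c d; rewrite /f kD (retensorD sub1) canD.
have fE a a' : f ((a *: g) *:r a') = (a *: h) *:r a'.
  by rewrite /f -canE kK (retensorE sub1) canE [a * _]mulr1 [_ * a']mul1r.
have fZ a c : f (a *: c) = a *: f c.
  move: c; apply: (galois_span gG) => [b b'|c d ec ed]; last first.
    by rewrite scalerDr !fD ec ed scalerDr.
  by rewrite scale_rscale scalerA !fE scale_rscale scalerA.
have fZr c a : f (c *:r a) = f c *:r a.
  move: c; apply: (galois_span gG) => [b b'|c d ec ed]; last first.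
    by rewrite rscaleDl !fD ec ed rscaleDl.
  by rewrite -rscaleA !fE rscaleA.
have fH : bimod_hom f by split=> // a c d; rewrite fD fZ.
have fg : f g = h by have := fE 1 1; rewrite !scale1r !rscale1.
exists f; split=> //; split=> // c.
- move: c; apply: (galois_span gG) => [a a'|c d ec ed].
    rewrite fE !(bimod_homZr comul_hom) !(bimod_homZ comul_hom) gg hh.
    by rewrite !scale_tens !rscale_tens tensor_map_homE // fZ fZr fg.
  by rewrite fD !(bimod_homD comul_hom) ec ed tensor_map_homD.
- move: c; apply: (galois_span gG) => [a a'|c d ec ed].
    by rewrite fE !counit_rscale !counitZ g1 h1.
  have eD (x y : C) : counit (x + y) = counit x + counit y.
    by have := @counit_scalar _ C 1 x y; rewrite scale1r mul1r.
  by rewrite fD !eD ec ed.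
Qed.

(** The two inclusions of coinvariants give coring maps g |-> h and h |-> g; their
    composites fix a Galois grouplike, hence are identities. *)
Lemma exists_aut (g h : galois_grouplike C) :
  coinv g =i coinv h -> exists phi : coring_aut C, gal_aut phi g = h.
Proof.
move=> gh; have gG := galP g; have hG := galP h.
have [f [fC fg]] : exists f : C -> C, coring_hom f /\ f g = h.
  apply: exists_coring_hom => //; first by case: hG.
  by move=> a ga; have := gh a; rewrite -!topredE /= ga => <-.
have [f' [fC' fh]] : exists f : C -> C, coring_hom f /\ f h = g.
  apply: exists_coring_hom => //; first by case: gG.
  by move=> a ha; have := gh a; rewrite -!topredE /= ha.
have [fH _ _] := fC; have [fH' _ _] := fC'.
have fB : bijective f.
  exists f'.
    by apply: (eq_bimod_hom gG (bimod_hom_comp fH' fH) (bimod_hom_id C)); rewrite /= fg.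
  by apply: (eq_bimod_hom hG (bimod_hom_comp fH fH') (bimod_hom_id C)); rewrite /= fh.
by exists (CoringAut (conj fC fB)); apply: gal_val_inj.
Qed.
End GaloisGrouplikes.

Section UnitSequence.
Variables (A : pzRingType) (C : coringType A) (g : galois_grouplike C).

Lemma transitive_of_descent1 :
  descent1 C = [set conj_orbit g] -> transitive_action (@gal_conj A C).
Proof.
move=> D1; have orb (x : galois_grouplike C) : exists u, gal_conj u g = x.
  have : conj_orbit g (x : C).
    have : descent1 C (conj_orbit x) by exists (x : C) => //; case: (galP x).
    by rewrite D1 => /= <-; exists 1%g => //; rewrite gconj1.
  by case=> u _ ux; exists u; exact: gal_val_inj.
move=> x y; case: (orb x) (orb y) => u <- [v <-].
by exists (v * u^-1)%g; apply: gal_val_inj; rewrite /= -gconjM mulgVK.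
Qed.

Lemma range_coinv_units :
  range (@coinv_units A C g) = [set u | gconj u g = g].
Proof.
apply/seteqP; split=> [_ [u _ <-]|u /= /eqP gu].
  by apply/eqP; rewrite gconj_fixE; exact: valP.
have gV : coinv g (unit_inv u).
  have /eqP e := gu; rewrite -(gconj_fixE (u^-1)%g).
  by rewrite -{1}e -gconjM mulVg gconj1.
have gU : coinv g (unit_val u) by rewrite -gconj_fixE.
pose a : coinv_ring g := exist (fun x => is_true (coinv g x)) _ gU.
pose b : coinv_ring g := exist (fun x => is_true (coinv g x)) _ gV.
have ab : a * b = 1 by apply: val_inj; exact: unit_mulV.
have ba : b * a = 1 by apply: val_inj; exact: unit_mulVl.
by exists (mk_unit ab ba) => //; exact: unit_val_inj.
Qed.

Lemma coinv_units_inj : injective (@coinv_units A C g).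
Proof.
move=> u v e; apply: unit_val_inj; apply: val_inj.
exact: (congr1 (@unit_val A) e).
Qed.

Hypothesis U_transitive : transitive_action (@gal_conj A C).

Lemma coinv_constP :
  norm_units g = [set: units A] <->
  forall h : galois_grouplike C, coinv h =i coinv g.
Proof.
split=> [Ng h|e].
  by have [u <-] := U_transitive g h; apply/norm_unitsP; rewrite Ng.
apply/seteqP; split=> // u _; apply/norm_unitsP; exact: (e (gal_conj u g)).
Qed.

Hypothesis coinv_const : forall h : galois_grouplike C, coinv h =i coinv g.

Lemma xi_bijective : bijective (xi g).
Proof.
have surj h : exists phi, xi g phi = h.
  by apply: exists_aut => a; rewrite coinv_const.
have [k kK] := choice surj.
by exists k => // phi; apply: (@xi_inj _ _ g); rewrite kK.
Qed.

Lemma exists_short_exact (xi_bij : bijective (xi g)) :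
  exists p : {multiplicative units A -> transported xi_bij},
    short_exact (@coinv_units A C g) p.
Proof.
(* with u instead of u^-1 this would be an antihomomorphism *)
pose p (u : units A) : transported xi_bij := gal_conj (u^-1)%g g.
have pM : {morph p : u v / (u * v)%g}.
  move=> u v; have /= eu := untransportK (p u); have /= ev := untransportK (p v).
  rewrite -[in RHS]eu -[in RHS]ev -transportM; apply: gal_val_inj => /=.
  set phi := untransport (p u); set psi := untransport (p v).
  have phiE : phi (g : C) = gconj (u^-1)%g g by have := congr1 (@gal_val A C) eu.
  have psiE : psi (g : C) = gconj (v^-1)%g g by have := congr1 (@gal_val A C) ev.
  (* A-linearity moves the inner conjugation outside, in the opposite order *)
  by rewrite psiE aut_gconj phiE -gconjM invgM.
pose pH := isMultiplicative.Build (units A) (transported xi_bij) p pM.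
pose P : {multiplicative units A -> transported xi_bij} := HB.pack p pH.
have p1 : (1%g : transported xi_bij) = g by exact: gal_val_inj.
exists P; split; first exact: coinv_units_inj.
  rewrite range_coinv_units; apply/seteqP; split=> u /= e.
    by rewrite p1; apply: gal_val_inj; rewrite /= -{1}e -gconjM mulVg gconj1.
  have gu : gconj (u^-1)%g g = g by rewrite p1 in e; have := congr1 (@gal_val A C) e.
  by rewrite -{1}gu -gconjM mulgV gconj1.
apply/seteqP; split=> // h _; have [u <-] := U_transitive g h.
by exists (u^-1)%g => //=; rewrite /p invgK.
Qed.
End UnitSequence.

(* The K-algebra structure of A is given by its central structure map eta,     *)
(* as algType would exclude the zero ring.                                     *)
Theorem theorem2p6 (K : comPzRingType) (A : pzRingType)
    (eta : {rmorphism K -> A}) (eta_central : forall k a, eta k * a = a * eta k)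
    (C : coringType A) (g : galois_grouplike C) :
  let U_transitive := transitive_action (@gal_conj A C) in
  let cond_i := norm_units g = [set: units A] in
  let cond_ii := forall h : galois_grouplike C, norm_units h = [set: units A] in
  let cond_iii := transitive_action (@gal_aut A C) in
  (descent1 C = [set conj_orbit g] -> U_transitive) /\
  (U_transitive ->
    [/\ cond_i <-> cond_ii,
        cond_i <-> cond_iii
      & cond_i \/ cond_ii \/ cond_iii ->
        (forall h : galois_grouplike C, coinv h =i coinv g) /\
        (exists xi_bij : bijective (xi g),
           exists p : {multiplicative units A -> transported xi_bij},
             short_exact (@coinv_units A C g) p)]).
Proof.
move=> U_transitive cond_i cond_ii cond_iii; split; first exact: transitive_of_descent1.
move=> trU; have constP := coinv_constP g trU.
have i_ii : cond_i <-> cond_ii.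
  split=> [Ng h|]; last by move/(_ g).
  by rewrite (eq_norm_units ((constP.1 Ng) h)).
have i_iii : cond_i <-> cond_iii.
  split=> [/constP e x y|trA].
    by apply: exists_aut => a; rewrite !e.
  by apply/constP => h; have [phi <-] := trA g h; exact: coinv_aut.
split=> // conds; have {conds}/constP e : cond_i by case: conds => [//|[/i_ii|/i_iii]].
split=> //; exists (xi_bijective e); exact: exists_short_exact.
Qed.
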